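(* Let $m\geq 1$ and $n\geq 1$ be integers and let $F_{n,m}=E_n+P_m$. Then $$\alpha(F_2(F_{n,m}))=\begin{cases} n\left\lceil\frac{m}{2}\right\rceil+\binom{\lfloor m/2\rfloor}{2} & \text{if } n\in\{\frac{m+1}{2},\frac{m+3}{2}\},\\[2pt] \left\lfloor\frac{m^2}{4}\right\rfloor+\binom{n}{2} & \text{otherwise.}\end{cases}$$
   Context: $E_n$ is the edgeless graph on $n$ vertices and $P_m$ the path on $m$ vertices. The join $G_1+G_2$ of disjoint graphs has vertex set $V(G_1)\cup V(G_2)$ and edge set $E(G_1)\cup E(G_2)\cup\{uv: u\in V(G_1), v\in V(G_2)\}$. For a finite simple graph $G$, the $2$-token graph $F_2(G)$ has as vertices the $2$-element subsets of $V(G)$, two adjacent iff their symmetric difference is an edge of $G$. $\alpha$ is the independence number, and $\binom{j}{k}=0$ when $j<k$. *)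

(* Defs.v *)
From mathcomp Require Import all_boot.

Set Implicit Arguments.
Unset Strict Implicit.
Unset Printing Implicit Defensive.

Record sgraph := SGraph {
  vertex :> finType;
  edge : rel vertex;
  edge_sym : symmetric edge;
  edge_irr : irreflexive edge
}.

Definition independent (G : sgraph) (S : {set G}) : bool :=
  [forall x in S, forall y in S, ~~ edge x y].

Definition alpha (G : sgraph) : nat :=
  \max_(S : {set G} | independent S) #|S|.

Section Edgeless.
Variable n : nat.

Definition edgeless_edge : rel 'I_n := fun _ _ => false.

Lemma edgeless_sym : symmetric edgeless_edge.
Proof. by []. Qed.

Lemma edgeless_irr : irreflexive edgeless_edge.
Proof. by []. Qed.

Definition edgeless : sgraph := SGraph edgeless_sym edgeless_irr.
End Edgeless.

Section Path.
Variable m : nat.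

Definition path_edge : rel 'I_m :=
  fun i j => (i.+1 == j :> nat) || (j.+1 == i :> nat).

Lemma path_sym : symmetric path_edge.
Proof. by move=> i j; rewrite /path_edge orbC. Qed.

Lemma path_irr : irreflexive path_edge.
Proof. by move=> i; rewrite /path_edge orbb; apply/negbTE; rewrite gtn_eqF. Qed.

Definition path_graph : sgraph := SGraph path_sym path_irr.
End Path.

Section Join.
Variables G1 G2 : sgraph.

Definition join_edge : rel (G1 + G2)%type := fun u v =>
  match u, v with
  | inl x, inl y => edge x y
  | inr x, inr y => edge x y
  | _, _ => true
  end.

Lemma join_sym : symmetric join_edge.
Proof. by case=> x [] y //=; rewrite edge_sym. Qed.

Lemma join_irr : irreflexive join_edge.
Proof. by case=> x /=; rewrite edge_irr. Qed.

Definition join_graph : sgraph := SGraph join_sym join_irr.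
End Join.

Section Token.
Variable G : sgraph.

Definition symdiff (A B : {set G}) : {set G} := (A :\: B) :|: (B :\: A).

Definition token2_vertex : finType := {A : {set G} | #|A| == 2}.

Definition token2_edge : rel token2_vertex := fun A B =>
  [exists x : G, exists y : G,
     edge x y && (symdiff (val A) (val B) == [set x; y])].

Lemma token2_sym : symmetric token2_edge.
Proof. by move=> A B; rewrite /token2_edge /symdiff setUC. Qed.

Lemma token2_irr : irreflexive token2_edge.
Proof.
move=> A; apply/negbTE/existsPn => x; apply/existsPn => y.
rewrite negb_and /symdiff setDv setU0; apply/orP; right.
by apply/eqP => /setP/(_ x); rewrite !inE eqxx.
Qed.

Definition token2 : sgraph := SGraph token2_sym token2_irr.
End Token.

Definition fan_graph (n m : nat) : sgraph :=
  join_graph (edgeless n) (path_graph m).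

(* Main.v *)
(** An independent set of the 2-token graph is a set of pairs, i.e. a symmetric irreflexive
relation [r] with no [r u v], [r u w] for an edge [v w]; summing [r] counts every pair twice.
For the join of E_n and P_m, let the slice of [e] in E_n consist of the path vertices paired
with [e], let A be a largest slice, s = |A|, and let k be the number of nonempty slices.
Pairs inside E_n avoid the k vertices with nonempty slices, mixed pairs number at most k s, and
pairs inside P_m avoid A. The latter are bounded by cutting the path into the t = m/2 blocks
{2i, 2i+1}: a 2 x 2 product of blocks carries at most 2 entries of [r], at most 1 if A meets
one of the blocks, and none if moreover the two blocks coincide. This gives, for m even, at most 2 (t^2 - t s) + s^2 - s ordered pairs, and the
bound to be shown reduces to d (d - 1) >= 0 with d = k - s; for m odd with A meeting the last
vertex it reduces to d (d - 3) >= 0 (s not counting that vertex), which fails only for d = 1, 2,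
and then only the extremal case k = n, s = t exceeds the generic value. *)

Require Import Defs.
From mathcomp Require Import all_boot.
From mathcomp Require Import zify.

Set Implicit Arguments.
Unset Strict Implicit.
Unset Printing Implicit Defensive.

(** * Independent sets of the 2-token graph as symmetric relations *)

Definition cherry_free (G : sgraph) (r : rel G) :=
  forall u v w, edge v w -> r u v -> ~~ r u w.

Definition pair_rel (T : finType) (S : {set {A : {set T} | #|A| == 2}}) : rel T :=
  fun u v => [exists A in S, val A == [set u; v]].

Lemma set2_inj (T : finType) (u v x y : T) :
  x != y -> [set u; v] = [set x; y] -> (u, v) = (x, y) \/ (u, v) = (y, x).
Proof.
move=> neqxy eS.
have : v \in [set x; y] by rewrite -eS set22.
have : u \in [set x; y] by rewrite -eS set21.
have : y \in [set u; v] by rewrite eS set22.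
have : x \in [set u; v] by rewrite eS set21.
rewrite !inE => xuv yuv /orP[]/eqP ? /orP[]/eqP ?; subst; try by [left|right].
  by rewrite orbb eq_sym (negbTE neqxy) in yuv.
by rewrite orbb (negbTE neqxy) in xuv.
Qed.

Lemma pair_rel_sym (T : finType) (S : {set {A : {set T} | #|A| == 2}}) :
  symmetric (pair_rel S).
Proof. by move=> u v; rewrite /pair_rel setUC. Qed.

Lemma pair_rel_irr (T : finType) (S : {set {A : {set T} | #|A| == 2}}) :
  irreflexive (pair_rel S).
Proof.
move=> u; apply/negbTE/existsPn => -[A cA] /=.
apply/negP => /andP[_ /eqP eqA]; move: cA.
by rewrite eqA cards2 eqxx.
Qed.

(** After exchanging the sums, each 2-set {x, y} is met exactly at (x, y) and (y, x). *)
Lemma sum_pair_rel (T : finType) (S : {set {A : {set T} | #|A| == 2}}) :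
  \sum_u \sum_v pair_rel S u v = #|S|.*2.
Proof.
have rE u v : pair_rel S u v = \sum_(A in S) (val A == [set u; v]) :> nat.
  rewrite /pair_rel; case: existsP => [[A /andP[AS /eqP eqA]]|noA].
    rewrite (bigD1 A) //= eqA eqxx big1 // => B /andP[_ neqB].
    by rewrite -eqA val_eqE (negbTE neqB).
  rewrite big1 // => A AS; case: eqP => // eqA.
  by case: noA; exists A; rewrite AS eqA /=.
under eq_bigr => u _ do under eq_bigr => v _ do rewrite rE.
rewrite pair_bigA exchange_big /= -muln2 -sum_nat_const; apply: eq_bigr => -[A cA] _ /=.
have [x [y [neqxy ->]]] := cards2P _ cA.
rewrite (bigD1 (x, y)) //= eqxx (bigD1 (y, x)) /=; last first.
  by rewrite xpair_eqE (negbTE neqxy) andbF.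
rewrite setUC eqxx big1 // => -[u v] /= /andP[n1 n2].
by case: eqP => // /esym; rewrite [RHS]setUC => /(set2_inj neqxy)[] e;
  rewrite e eqxx in n1 n2.
Qed.

(** Both sets have size 2, so their two differences have equal size; these sizes add up to 2, which
    leaves one point in each difference and one common point. *)
Lemma token2_edgeP (G : sgraph) (A B : token2 G) :
  reflect (exists u v w, [/\ edge v w, val A = [set u; v] & val B = [set u; w]])
          (edge A B).
Proof.
apply: (iffP idP) => [/existsP[x /existsP[y /andP[exy /eqP dAB]]]|].
  have neqxy : x != y by apply: contraTneq exy => ->; rewrite edge_irr.
  have cA := cardsID (val B) (val A); have cB := cardsID (val A) (val B).
  have cD : #|val A :\: val B| + #|val B :\: val A| = 2.
    transitivity #|[set x; y]|; last by rewrite cards2 neqxy.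
    rewrite -dAB /symdiff cardsU.
    suff -> : (val A :\: val B) :&: (val B :\: val A) = set0 by rewrite cards0 subn0.
    by apply/setP => z; rewrite !inE; do 2 case: (z \in _).
  rewrite setIC in cB; rewrite (eqP (valP A)) in cA; rewrite (eqP (valP B)) in cB.
  have /cards1P[u eu] : #|val A :&: val B| == 1 by apply/eqP; lia.
  have /cards1P[v ev] : #|val A :\: val B| == 1 by apply/eqP; lia.
  have /cards1P[w ew] : #|val B :\: val A| == 1 by apply/eqP; lia.
  exists u, v, w; split.
  - move: dAB; rewrite /symdiff ev ew => /(set2_inj neqxy)[] [-> ->] //.
    by rewrite edge_sym.
  - by rewrite -eu -ev setID.
  - by rewrite -eu -ew setIC setID.
case=> u [v [w [evw eA eB]]]; apply/existsP; exists v; apply/existsP; exists w.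
rewrite evw /symdiff eA eB /=.
have nvw : v != w by apply: contraTneq evw => ->; rewrite edge_irr.
have nuv : u != v by have := valP A; rewrite /= eA cards2; case: (u == v).
have nuw : u != w by have := valP B; rewrite /= eB cards2; case: (u == w).
apply/eqP/setP => z; rewrite !inE.
case: (z =P v) => [->|_]; rewrite /= ?orbT.
  by rewrite eq_sym (negbTE nuv) (negbTE nvw).
case: (z =P w) => [->|_]; rewrite /= ?orbT ?orbF.
  by rewrite eq_sym (negbTE nuw).
by case: (z == u).
Qed.

Lemma independent_pair_rel (G : sgraph) (S : {set token2 G}) :
  independent S <-> cherry_free (pair_rel S).
Proof.
split=> [iS u v w evw /existsP[A /andP[AS /eqP eA]] | cf].
  apply/existsP => -[B /andP[BS /eqP eB]].
  move/forallP/(_ A): iS; rewrite AS /= => /forallP/(_ B); rewrite BS /=.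
  by move/negP; apply; apply/token2_edgeP; exists u, v, w.
apply/forallP => A; apply/implyP => AS; apply/forallP => B; apply/implyP => BS.
apply/token2_edgeP => -[u [v [w [evw eA eB]]]].
have ruv : pair_rel S u v by apply/existsP; exists A; rewrite AS eA /=.
have ruw : pair_rel S u w by apply/existsP; exists B; rewrite BS eB /=.
by have := cf _ _ _ evw ruv; rewrite ruw.
Qed.

Lemma alpha_token2_ub (G : sgraph) c :
  (forall r : rel G, symmetric r -> irreflexive r -> cherry_free r ->
     \sum_u \sum_v r u v <= c.*2) ->
  alpha (token2 G) <= c.
Proof.
move=> ub; apply/bigmax_leqP => S /independent_pair_rel cf.
by rewrite -leq_double -sum_pair_rel ub //; [apply: pair_rel_sym|apply: pair_rel_irr].
Qed.

(** The supports {u, v} of the true entries of [r] form a set [S]; symmetry and irreflexivity make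
    [pair_rel S] equal to [r] again. *)
Lemma alpha_token2_lb (G : sgraph) (r : rel G) :
  symmetric r -> irreflexive r -> cherry_free r ->
  \sum_u \sum_v r u v <= (alpha (token2 G)).*2.
Proof.
move=> rs ri cf.
pose S : {set token2 G} :=
  [set A : token2 G | [exists u, exists v, r u v && (val A == [set u; v])]].
have rE u v : pair_rel S u v = r u v.
  apply/existsP/idP => [[A /andP[]]|ruv].
    rewrite inE => /existsP[x /existsP[y /andP[rxy /eqP ->]]] /eqP /esym eS.
    have nxy : x != y by apply: contraTneq rxy => ->; rewrite ri.
    by case: (set2_inj nxy eS) => [] [-> ->]; last rewrite rs.
  have nuv : u != v by apply: contraTneq ruv => ->; rewrite ri.
  have cA : #|[set u; v]| == 2 by rewrite cards2 nuv.
  exists (Sub [set u; v] cA); rewrite inE SubK eqxx andbT.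
  by apply/existsP; exists u; apply/existsP; exists v; rewrite ruv /=.
under eq_bigr => u _ do under eq_bigr => v _ do rewrite -rE.
rewrite sum_pair_rel leq_double /alpha.
apply: (@leq_bigmax_cond _ (@independent (token2 G)) (fun A => #|A|)).
apply/independent_pair_rel => u v w evw; rewrite !rE; exact: cf.
Qed.

(** * Pairs of path vertices, summed over blocks of two *)

Lemma sum_ord_double (f : nat -> nat) t :
  \sum_(p < t.*2) f p = \sum_(i < t) (f i.*2 + f i.*2.+1).
Proof.
elim: t => [|t IH]; first by rewrite !big_ord0.
by rewrite doubleS !big_ord_recr /= IH addnA.
Qed.

Lemma sum_ord_double2 (z : nat -> nat -> nat) t :
  \sum_(p < t.*2) \sum_(q < t.*2) z p q =
  \sum_(i < t) \sum_(j < t) (z i.*2 j.*2 + z i.*2 j.*2.+1 +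
                            (z i.*2.+1 j.*2 + z i.*2.+1 j.*2.+1)).
Proof.
rewrite (sum_ord_double (fun p => \sum_(q < t.*2) z p q)).
apply: eq_bigr => i _.
rewrite (sum_ord_double (z i.*2)) (sum_ord_double (z i.*2.+1)) -big_split.
by [].
Qed.

Section PathPairs.
Variables (z : rel nat) (a : pred nat).
Hypotheses (z_sym : symmetric z) (z_irr : irreflexive z)
  (z_path : forall p q, ~~ (z p q && z p q.+1))
  (a_path : forall p, ~~ (a p && a p.+1))
  (za : forall p q, a p -> ~~ z p q).

Lemma sum_even_path t (s := \sum_(p < t.*2) a p) :
  \sum_(p < t.*2) \sum_(q < t.*2) z p q + t * s * 2 + s <= 2 * t ^ 2 + s ^ 2.
Proof.
pose c i : nat := a i.*2 + a i.*2.+1.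
have sE : s = \sum_(i < t) c i by rewrite /s (sum_ord_double a).
have diag : \sum_(i < t) \sum_(j < t) (i == j) * c i = s.
  rewrite sE; apply: eq_bigr => i _; rewrite (bigD1 i) //= eqxx mul1n.
  by rewrite big1 ?addn0 // => j /negbTE; rewrite eq_sym => ->.
have rows : \sum_(i < t) \sum_(j < t) c i = t * s.
  by rewrite sE big_distrr; apply: eq_bigr => i _; rewrite sum_nat_const card_ord.
have cols : \sum_(i < t) \sum_(j < t) c j = t * s.
  by rewrite -sE sum_nat_const card_ord.
have prods : \sum_(i < t) \sum_(j < t) c i * c j = s ^ 2.
  rewrite sE -mulnn big_distrl; apply: eq_bigr => i _ /=.
  by rewrite big_distrr.
have twos : \sum_(i < t) \sum_(j < t) 2 = 2 * t ^ 2.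
  by rewrite !sum_nat_const card_ord; lia.
(* With [c i] the number of points of [a] in block i, the claim is the sum over all (i, j) of
   [B i j + (c i + c j) + (i == j) * c i <= 2 + c i * c j], [B i j] being the block sum of [z]. *)
rewrite (sum_ord_double2 z) muln2 -addnn.
rewrite -[X in _ + X <= _]diag -[X in _ + (X + _) + _]rows.
rewrite -[X in _ + (_ + X) + _]cols -prods -twos.
rewrite -!big_split; apply: leq_sum => i _.
rewrite -!big_split; apply: leq_sum => j _ /=; rewrite /c.
have := z_path i.*2 j.*2; have := z_path i.*2.+1 j.*2.
have := z_path j.*2 i.*2; have := z_path j.*2.+1 i.*2.
have := @za i.*2 j.*2; have := @za i.*2 j.*2.+1.
have := @za i.*2.+1 j.*2; have := @za i.*2.+1 j.*2.+1.
have := @za j.*2 i.*2; have := @za j.*2 i.*2.+1.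
have := @za j.*2.+1 i.*2; have := @za j.*2.+1 i.*2.+1.
have := a_path i.*2; have := a_path j.*2.
rewrite (z_sym j.*2 i.*2) (z_sym j.*2 i.*2.+1).
rewrite (z_sym j.*2.+1 i.*2) (z_sym j.*2.+1 i.*2.+1).
have [->|] := eqVneq i j.
  rewrite !z_irr (z_sym j.*2.+1 j.*2).
  by do 2 case: (a _) => //=; case: (z _ _) => //= *; lia.
do 4 case: (a _) => //=; do 4 case: (z _ _) => //=; lia.
Qed.

Lemma sum_even_leq t : \sum_(p < t.*2) a p <= t.
Proof.
rewrite (sum_ord_double a) -[leqRHS]card_ord -sum1_card; apply: leq_sum => i _.
by have := a_path i.*2; lia.
Qed.

(** The last vertex is paired with at most one vertex of each block, and with none if [a] holds
    there. Its row and its column contribute equally, hence the factor 2. *)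
Lemma sum_odd_path t (l : nat := a t.*2) :
  \sum_(p < t.*2.+1) \sum_(q < t.*2.+1) z p q + 2 * t * l <=
  \sum_(p < t.*2) \sum_(q < t.*2) z p q + 2 * t.
Proof.
have last_col : \sum_(p < t.*2) z p t.*2 + t * l <= t.
  rewrite (sum_ord_double (fun p => z p t.*2)) /l.
  have [at2|_] := boolP (a _).
    rewrite big1 ?add0n ?muln1 // => i _.
    by rewrite z_sym (negbTE (za _ at2)) z_sym (negbTE (za _ at2)).
  rewrite muln0 addn0 -[leqRHS]card_ord -sum1_card; apply: leq_sum => i _.
  by have := z_path t.*2 i.*2; rewrite z_sym [z t.*2 _]z_sym; lia.
have last_row : \sum_(q < t.*2) z t.*2 q = \sum_(p < t.*2) z p t.*2.
  by apply: eq_bigr => i _; rewrite z_sym.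
rewrite [X in X + _]big_ord_recr [X in _ + X + _]big_ord_recr /= z_irr.
under eq_bigr => p _ do rewrite big_ord_recr /=.
rewrite big_split /= last_row addn0 -mulnA -!addnA leq_add2l.
by move: last_col; set S := (\sum_(p < _) _); set T := t * l; lia.
Qed.
End PathPairs.

(** * Counting the pairs of the join by type *)

Lemma sum_sumType (S T : finType) (r : rel (S + T)%type) :
  symmetric r ->
  \sum_u \sum_v r u v =
  \sum_x \sum_y r (inl x) (inl y) + (\sum_x \sum_y r (inl x) (inr y)).*2 +
  \sum_x \sum_y r (inr x) (inr y).
Proof.
move=> rs; rewrite big_sumType /= -addnn addnA.
under eq_bigr => x _ do rewrite big_sumType /=.
under [X in _ + X]eq_bigr => x _ do rewrite big_sumType /=.
rewrite !big_split /= [X in _ + (X + _)]exchange_big /=.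
under [X in _ + (X + _)]eq_bigr => x _ do under eq_bigr => y _ do rewrite rs.
by rewrite addnA.
Qed.

Lemma sum_mem (T : finType) (A : {set T}) : \sum_x (x \in A) = #|A|.
Proof. by rewrite -sum1_card [RHS]big_mkcond; apply: eq_bigr => x _; case: (x \in A). Qed.

Lemma fan_rel_ub n m (r : rel ('I_n + 'I_m)%type) :
  0 < n -> symmetric r -> irreflexive r -> cherry_free (G := fan_graph n m) r ->
  exists (k : nat) (z : rel nat) (a : pred nat),
    [/\ k <= n,
        [/\ symmetric z, irreflexive z & forall p q, ~~ (z p q && z p q.+1)],
        forall p, ~~ (a p && a p.+1),
        forall p q, a p -> ~~ z p q &
        \sum_u \sum_v r u v <=
          (n - k) * (n - k).-1 + 2 * (k * \sum_(p < m) a p) +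
          \sum_(p < m) \sum_(q < m) z p q].
Proof.
move=> n0 rs ri cf.
pose slice e : {set 'I_m} := [set p | r (inl e) (inr p)].
pose K := [set e | slice e != set0].
case: (@arg_maxnP _ (Ordinal n0) predT (fun e => #|slice e|)) => // e0 _ max_e0.
(* Extending by [false] beyond [m] lets the block arithmetic run on [nat] without range
   conditions. *)
pose z : rel nat := fun i j =>
  if insub i is Some p then if insub j is Some q then r (inr p) (inr q) else false
  else false.
pose a : pred nat := fun i => if insub i is Some p then p \in slice e0 else false.
have zE (p q : 'I_m) : z p q = r (inr p) (inr q) by rewrite /z !valK.
have aE (p : 'I_m) : a p = (p \in slice e0) by rewrite /a valK.
exists #|K|, z, a; split.
- by rewrite -[leqRHS]card_ord max_card.
- split=> [i j|i|i j].
  + by rewrite /z; do 2 case: insubP => // *; rewrite rs.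
  + by rewrite /z; case: insubP => // *; rewrite ri.
  + rewrite /z; case: insubP => //= p _ _; case: insubP => //= q _ qj.
    case: insubP => [q' _ q'j|_]; last by rewrite andbF.
    apply/negP => /andP[zq]; apply/negP; apply: cf zq => /=.
    by rewrite /path_edge qj q'j eqxx.
- move=> i; rewrite /a; case: insubP => //= p _ pi.
  case: insubP => [p' _ p'i|_]; last by rewrite andbF.
  rewrite !inE; apply/negP => /andP[yp]; apply/negP; apply: cf yp => /=.
  by rewrite /path_edge pi p'i eqxx.
(* In the join [e0] is adjacent to every path vertex, so a vertex paired with [e0] is paired with no
   path vertex. *)
- move=> i j; rewrite /a /z; case: insubP => //= p _ _; case: insubP => //= q _ _.
  by rewrite inE rs; apply: cf.
rewrite (sum_sumType rs) -muln2 [_ * 2]mulnC; apply: leq_add; first apply: leq_add.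
- have -> : n - #|K| = #|~: K| by have := cardsC K; rewrite card_ord; lia.
  (* If x and y of E_n are paired, x is paired with no neighbour of y, hence with no path vertex; so
     both have empty slices. *)
  apply: leq_trans (_ : \sum_e \sum_e' (e \in ~: K) * (e' \in ~: K :\ e) <= _).
    apply: leq_sum => e _; apply: leq_sum => e' _.
    case ree': (r _ _) => //.
    have slice0 x y : r (inl x) (inl y) -> slice x == set0.
      move=> rxy; apply/eqP/setP => p; rewrite !inE; apply/negbTE.
      by apply: cf rxy.
    have nee' : e' != e by apply: contraTneq ree' => ->; rewrite ri.
    by rewrite !inE !negbK (slice0 _ _ ree') (slice0 e' e) 1?rs ?nee'.
  rewrite -[X in _ <= X * _]sum_mem big_distrl.
  apply: leq_sum => e _ /=; rewrite -big_distrr /= sum_mem.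
  by case eK: (e \in ~: K) => //; rewrite (cardsD1 e (~: K)) eK.
- rewrite leq_mul2l /=.
  have -> : \sum_(p < m) a p = #|slice e0|.
    by rewrite -sum_mem; apply: eq_bigr => p _; rewrite aE.
  rewrite -[#|K|]sum_mem big_distrl; apply: leq_sum => e _ /=.
  have -> : \sum_p r (inl e) (inr p) = #|slice e|.
    by rewrite -sum_mem; apply: eq_bigr => p _; rewrite inE.
  rewrite inE; case: eqP => [->|_]; rewrite ?cards0 //= mul1n.
  exact: max_e0.
by apply: leq_sum => p _; apply: leq_sum => q _; rewrite zE.
Qed.

(** * Arithmetic of the bounds *)

Lemma mul_pred_add n : n * n.-1 + n = n * n.
Proof. by case: n => //= n; lia. Qed.

(** With n = k + x, t = s + y and d = k - s, the slack is at least d(d - 1) + 2kx + 2sy; the sign of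
    d is split to stay in [nat]. *)
Lemma fan_bound_even n k t s e : k <= n -> s <= t ->
  e + t * s * 2 + s <= 2 * t ^ 2 + s ^ 2 ->
  (n - k) * (n - k).-1 + 2 * (k * s) + e <= 2 * t ^ 2 + n * n.-1.
Proof.
move=> /subnKC <- /subnKC <-; rewrite addKn -!mulnn.
move: (n - k) (t - s) => x y.
have := mul_pred_add x; have := mul_pred_add (k + x).
move: (x * x.-1) ((k + x) * (k + x).-1) => X Y.
have [/subnKC <-|/subnKC <-] := leqP k s; [move: (s - k)|move: (k - s.+1)];
  move=> d; nia.
Qed.

(** In the same notation the slack is at least d(d - 3) + 2kx + 2(s + 1)y. For d = 1, 2 the first
    term is -2, which any positive x or y makes up for; x = y = 0 gives n = k, t = s and the second
    alternative. *)
Lemma fan_bound_odd n k t s e : k <= n -> s <= t ->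
  e + t * s * 2 + s <= 2 * t ^ 2 + s ^ 2 ->
  (n - k) * (n - k).-1 + 2 * (k * s.+1) + e <= 2 * t ^ 2 + 2 * t + n * n.-1
  \/ (n = t.+1 \/ n = t.+2) /\
     (n - k) * (n - k).-1 + 2 * (k * s.+1) + e <= 2 * (n * t.+1) + t * t.-1.
Proof.
move=> /subnKC <- /subnKC <-; rewrite addKn -!mulnn.
move: (n - k) (t - s) => x y.
have [/andP[dk xy0]|] := boolP (((k == s.+1) || (k == s.+2)) && (x + y == 0)).
  have [-> ->] : x = 0 /\ y = 0 by lia.
  rewrite !addn0; have := mul_pred_add s; move: (s * s.-1) => S eS eE.
  by right; split; [lia | case/orP: dk => /eqP ->; nia].
move=> ex eE; left; move: eE ex.
have := mul_pred_add x; have := mul_pred_add (k + x).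
move: (x * x.-1) ((k + x) * (k + x).-1) => X Y.
have [/subnKC <-|/subnKC <-] := leqP k s.
  by move: (s - k) => d eX eY eE _; nia.
(* The cases are k = s + 1, k = s + 2 (both with x + y > 0) and k >= s + 3. *)
case: (k - s.+1) => [|[|d]] eX eY eE.
- rewrite addn0 eqxx /= -lt0n => ?; nia.
- rewrite addn1 eqxx orbT /= -lt0n => ?; nia.
- by move=> _; nia.
Qed.

(** * Two explicit independent sets, for the lower bound *)

Lemma sum_odd m : \sum_(p < m) odd p = m./2.
Proof.
elim: m => [|m IH]; first by rewrite big_ord0.
by rewrite big_ord_recr /= IH uphalf_half addnC.
Qed.

Lemma sum_even m : \sum_(p < m) ~~ odd p = uphalf m.
Proof.
elim: m => [|m IH]; first by rewrite big_ord0.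
by rewrite big_ord_recr /= IH uphalf_half; lia.
Qed.

Lemma path_edge_odd m (p q : 'I_m) : path_edge p q -> odd q = ~~ odd p.
Proof. by rewrite /path_edge; lia. Qed.

Lemma sum_neq (T : finType) (P : pred T) :
  \sum_(x | P x) \sum_(y | P y) (x != y) = #|P| * #|P|.-1.
Proof.
rewrite -[X in X * _]sum1_card big_distrl; apply: eq_bigr => x Px /=.
have memP y : (y \in P) = P y by [].
rewrite mul1n (cardD1 x) memP Px -sum1_card [RHS]big_mkcond [LHS]big_mkcond.
apply: eq_bigr => y _; rewrite !inE eq_sym memP.
by case: (y == x); case: (P y).
Qed.

Lemma double_bin2 n : 'C(n, 2).*2 = n * n.-1.
Proof.
rewrite bin2; have := odd_double_half (n * n.-1).
have : ~~ odd (n * n.-1) by case: n => //= n; rewrite oddM /=; case: odd.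
by lia.
Qed.

(** Attains the generic value: a path edge changes parity, and no pair is mixed. *)
Definition bipartite_pairs n m : rel ('I_n + 'I_m)%type := fun u v =>
  match u, v with
  | inl e, inl e' => e != e'
  | inr p, inr q => odd p (+) odd q
  | _, _ => false
  end.

(** Attains the exceptional value: all slices equal the even positions, the larger parity class,
    leaving only the odd positions for pairs inside the path. *)
Definition even_slices n m : rel ('I_n + 'I_m)%type := fun u v =>
  match u, v with
  | inl _, inl _ => false
  | inl _, inr p | inr p, inl _ => ~~ odd p
  | inr p, inr q => [&& odd p, odd q & p != q]
  end.

Lemma alpha_fan_bipartite n m :
  m./2 * uphalf m + 'C(n, 2) <= alpha (token2 (fan_graph n m)).
Proof.
rewrite -leq_double.
apply: leq_trans (alpha_token2_lb (G := fan_graph n m) (r := @bipartite_pairs n m) _ _ _).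
- rewrite (@sum_sumType _ _ (@bipartite_pairs n m)); last first.
    by case=> x [] y //=; rewrite (eq_sym, addbC).
  rewrite /= sum_neq card_ord [X in _ + X.*2]big1; last by move=> e _; rewrite big1.
  have -> : \sum_(p < m) \sum_(q < m) (odd p (+) odd q) = (m./2 * uphalf m).*2.
    rewrite -addnn {1}[_ * uphalf m]mulnC -{1}sum_odd -{1}sum_even.
    rewrite -{1}sum_odd -{1}sum_even !big_distrl -big_split; apply: eq_bigr => p _ /=.
    rewrite !big_distrr -big_split; apply: eq_bigr => q _ /=.
    by case: odd; case: odd.
  by rewrite doubleD double_bin2 addn0 addnC.
- by case=> x [] y //=; rewrite (eq_sym, addbC).
- by case=> x /=; rewrite ?eqxx ?addbb.
by case=> [e|p] [e'|q] [e''|q'] //= /path_edge_odd ->; do 2 case: odd.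
Qed.

Lemma alpha_fan_slices n m :
  n * uphalf m + 'C(m./2, 2) <= alpha (token2 (fan_graph n m)).
Proof.
rewrite -leq_double.
have rs : symmetric (@even_slices n m).
  by case=> x [] y //=; rewrite eq_sym andbCA.
apply: leq_trans (alpha_token2_lb (G := fan_graph n m) (r := @even_slices n m) _ _ _) => //.
- rewrite (sum_sumType rs) /= big1; last by move=> e _; rewrite big1.
  rewrite sum_even sum_nat_const card_ord add0n.
  have sE : \sum_(p < m) \sum_(q < m) [&& odd p, odd q & p != q] = m./2 * m./2.-1.
    have <- : #|[pred p : 'I_m | odd p]| = m./2.
      by rewrite -sum1_card big_mkcond -sum_odd; apply: eq_bigr => p _; rewrite inE; case: odd.
    rewrite -sum_neq [RHS]big_mkcond; apply: eq_bigr => p _ /=.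
    case: (odd p) => /=; last by rewrite big1.
    by rewrite [RHS]big_mkcond; apply: eq_bigr => q _ /=; case: (odd q).
  by rewrite sE doubleD double_bin2.
- by case=> x //=; rewrite eqxx !andbF.
by case=> [e|p] [e'|q] [e''|q'] //=; try (by move=> /path_edge_odd ->; do 2 case: odd);
  move=> _; case: (odd p).
Qed.

(** * Comparison of the two values and conclusion *)

(** For m = 2t + 1 these are the two exceptional n; the doubled values differ by 2, so the slices
    win by one pair. *)
Lemma odd_fan_values n t : n = t.+1 \/ n = t.+2 ->
  2 * (n * t.+1) + t * t.-1 = 2 * t ^ 2 + 2 * t + n * n.-1 + 2.
Proof. by have := mul_pred_add t => et; case=> ->; rewrite -mulnn /=; nia. Qed.

Theorem theorem5 (m n : nat) (hm : 1 <= m) (hn : 1 <= n) :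
  alpha (token2 (fan_graph n m)) =
    if (n.*2 == m + 1) || (n.*2 == m + 3)
    then n * uphalf m + 'C(m./2, 2)
    else m ^ 2 %/ 4 + 'C(n, 2).
Proof.
have m24 : m ^ 2 %/ 4 = m./2 * uphalf m.
  rewrite uphalf_half -{1}(odd_double_half m) -mulnn.
  by case: (odd m); nia.
apply/eqP; rewrite eqn_leq; apply/andP; split; last first.
  by case: ifP => _; rewrite ?m24; [apply: alpha_fan_slices | apply: alpha_fan_bipartite].
apply: alpha_token2_ub => r rs ri cf; rewrite {}m24.
have [k [z [a [kn [zs zi zp] ap za ub]]]] := fan_rel_ub hn rs ri cf.
apply: leq_trans ub _; rewrite {r rs ri cf}.
rewrite uphalf_half; move: (odd_double_half m) => {hm}.
move: (odd m) m./2 => b t <- {m}.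
have st := sum_even_leq ap t; have He := sum_even_path zs zi zp ap za t.
have Ho := sum_odd_path zs zi zp za t.
have := double_bin2 n; have := double_bin2 t; have := @odd_fan_values n t.
move: 'C(n, 2) 'C(t, 2) => C D.
(* For even m the exceptional condition fails by parity. *)
case: b Ho => /= Ho gap eD eC; last first.
  have := fan_bound_even kn st He; rewrite !add0n -eC -mulnn ifF; last by lia.
  by rewrite doubleD -[(t * t).*2]mul2n.
rewrite !add1n (big_ord_recr t.*2) /=.
move: He Ho st; move: (\sum_(i < t.*2) a i) => s.
move: (\sum_(p < t.*2) _) (\sum_(p < t.*2.+1) _) => E O He Ho st.
(* If the largest slice contains the last vertex, its size is s + 1 and the odd bound applies.
   Otherwise the even bound plus 2t already gives the generic value. *)
have He' : (a t.*2 = 1 :> nat /\ O <= E) \/ (a t.*2 = 0 :> nat /\ O <= E + 2 * t).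
  by case: (a _) Ho => Ho; [left | right]; split=> //; lia.
rewrite -mulnn -eC -eD in gap.
case: He' => -[-> HO].
  have := fan_bound_odd kn st He; rewrite addn1 -!mulnn -eC -eD.
  move: ((n - k) * _) => X {He Ho eC eD}; case: ifP => en; last by lia.
  by have := gap (ltac:(lia)); lia.
have := fan_bound_even kn st He; rewrite addn0 -!mulnn -eC.
move: ((n - k) * _) => X {He Ho eC eD}; case: ifP => en; last by lia.
by have := gap (ltac:(lia)); lia.
Qed.
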